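(* Let $h$ be a left invariant Lorentzian metric on a connected Lie group $G$ of dimension three with Lie algebra $\mathfrak{g}$, and let $\{y_1,y_2,y_3\}$ be an $h$-orthonormal basis of $\mathfrak{g}$. If $u,v\in\mathfrak{g}$ are orthogonal vectors, i.e. $h(u,v)=0$, with $h(u,u)h(v,v)\neq0$ (so that $\kappa(u,v)$ is defined), then $$ h(u,u)h(v,v)\,\kappa(u,v)=-\left(\|u\times v\|^2\,\frac{\rho}{2}-\mathrm{ric}(u\times v,u\times v)\right). $$ In particular, \begin{align*} \kappa(y_1,y_2)&=\frac{\rho}{2}+\mathrm{ric}(y_3,y_3)=\frac12(R_{11}+R_{22}-R_{33}),\\ \kappa(y_2,y_3)&=\frac{\rho}{2}-\mathrm{ric}(y_1,y_1)=\frac12(-R_{11}+R_{22}+R_{33}),\\ \kappa(y_3,y_1)&=\frac{\rho}{2}-\mathrm{ric}(y_2,y_2)=\frac12(R_{11}-R_{22}+R_{33}), \end{align*} where $[R_{ij}]$ is the matrix of the Ricci operator $\mathrm{Ric}$ with respect to $\{y_1,y_2,y_3\}$.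
   Context: A left invariant Lorentzian metric $h$ on $G$ is identified with a nondegenerate symmetric bilinear form of signature $(+,+,-)$ on $\mathfrak{g}$. A basis $\{y_1,y_2,y_3\}$ is $h$-orthonormal if $h(y_1,y_1)=h(y_2,y_2)=1$, $h(y_3,y_3)=-1$ and $h(y_i,y_j)=0$ for $i\ne j$. The Lorentzian cross product (relative to this basis) is the bilinear skew-symmetric map on $\mathfrak{g}$ with $y_1\times y_2=-y_3$, $y_2\times y_3=y_1$, $y_3\times y_1=y_2$, and $\|u\|^2:=h(u,u)$. The Levi-Civita connection $\nabla:\mathfrak{g}\times\mathfrak{g}\to\mathfrak{g}$ is given by $2h(\nabla_uv,w)=h([u,v],w)+h([w,u],v)+h([w,v],u)$. The curvature is $R_{uv}=\nabla_{[u,v]}-(\nabla_u\nabla_v-\nabla_v\nabla_u)$; the Ricci curvature $\mathrm{ric}(u,v)$ is the trace of $w\mapsto R_{uw}v$; the Ricci operator $\mathrm{Ric}$ is defined by $h(\mathrm{Ric}(u),v)=\mathrm{ric}(u,v)$; the scalar curvature $\rho$ is the trace of $\mathrm{Ric}$; and the sectional curvature is $\kappa(u,v)=\dfrac{h(R_{uv}u,v)}{h(u,u)h(v,v)-h(u,v)^2}$ (for linearly independent $u,v$ with non-zero denominator). The $j$-th column of $[R_{ij}]$ is the coordinate vector of $\mathrm{Ric}(y_j)$. *)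

(* Defs.v *)
From HB Require Import structures.
From mathcomp Require Import all_boot all_order all_algebra.
From mathcomp Require Import boolp classical_sets reals.
From mathcomp Require Import ring.

Set Implicit Arguments.
Unset Strict Implicit.
Unset Printing Implicit Defensive.
Import Order.TTheory GRing.Theory Num.Theory.
Local Open Scope ring_scope.

Section LorentzianLieAlgebra.
Variables (R : realType) (g : vectType R).

(* Bilinearity of the bracket is carried by its type. *)
Record is_lie_bracket (br : {bilinear g -> g -> g}) : Prop := IsLieBracket {
  lie_alternating : forall x, br x x = 0;
  lie_jacobi : forall x y z, br x (br y z) + br y (br z x) + br z (br x y) = 0
}.

Definition has_signature_ppm (h : {symmetric g}) : Prop :=
  exists b1 b2 b3 : g,
    [/\ basis_of {:g} [:: b1; b2; b3],
        [/\ 0 < h b1 b1, 0 < h b2 b2 & h b3 b3 < 0]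
      & [/\ h b1 b2 = 0, h b1 b3 = 0 & h b2 b3 = 0]].

Definition is_lorentzian (h : {symmetric g}) : Prop :=
  nondegenerate h /\ has_signature_ppm h.

Definition is_orthonormal_basis (h : {symmetric g}) (y1 y2 y3 : g) : Prop :=
  [/\ basis_of {:g} [:: y1; y2; y3],
      [/\ h y1 y1 = 1, h y2 y2 = 1 & h y3 y3 = -1]
    & [/\ h y1 y2 = 0, h y1 y3 = 0 & h y2 y3 = 0]].

(* Bilinear extension of y1 x y2 = - y3, y2 x y3 = y1, y3 x y1 = y2;
   see lcross_basis. *)
Definition lcross (y1 y2 y3 u v : g) : g :=
  let c (i : 'I_3) w := coord [tuple y1; y2; y3] i w in
  (c 1 u * c 2%:R v - c 2%:R u * c 1 v) *: y1
  + (c 2%:R u * c 0 v - c 0 u * c 2%:R v) *: y2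
  - (c 0 u * c 1 v - c 1 u * c 0 v) *: y3.

(* The j-th column is the coordinate vector of f b_j. *)
Definition mx_in n (b : n.-tuple g) (f : g -> g) : 'M[R]_n :=
  \matrix_(i, j) coord b i (f b`_j).

(* The choice of basis is immaterial when f is linear (lintrace_basis). *)
Definition lintrace (f : g -> g) : R := \tr (mx_in (vbasis {:g}) f).

(* The vector representing the linear form phi with respect to h: it exists
   and is unique when h is nondegenerate (riesz_spec, riesz_unique). *)
Definition riesz (h : {symmetric g}) (phi : g -> R) : g :=
  xget 0 [set x : g | forall w, h x w = phi w]%classic.

Section Curvature.
Variables (br : {bilinear g -> g -> g}) (h : {symmetric g}).

(* Koszul formula, solved for nabla_u v; see nabla_koszul. *)
Definition nabla (u v : g) : g :=
  riesz h (fun w => 2^-1 * (h (br u v) w + h (br w u) v + h (br w v) u)).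

Definition curv (u v w : g) : g :=
  nabla (br u v) w - (nabla u (nabla v w) - nabla v (nabla u w)).

Definition ric (u v : g) : R := lintrace (fun w => curv u w v).

(* h (Ric u) v = ric u v; see Ric_spec. *)
Definition Ric (u : g) : g := riesz h (ric u).

Definition scal : R := lintrace Ric.

Definition sec (u v : g) : R :=
  h (curv u v u) v / (h u u * h v v - h u v ^+ 2).

Definition Ric_mx (y1 y2 y3 : g) : 'M[R]_3 :=
  mx_in [tuple y1; y2; y3] Ric.

End Curvature.

Lemma nondegenerateP (h : {symmetric g}) (x : g) :
  nondegenerate h -> (forall w, h x w = 0) -> x = 0.
Proof.
move=> /eqP hnd hx; apply/eqP; rewrite -memv0 -hnd.
by apply/(mem_orthovP (form := h)) => w _; exact: hx.
Qed.

Lemma riesz_spec (h : {symmetric g}) (phi : {scalar g}) :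
  nondegenerate h -> forall w, h (riesz h phi) w = phi w.
Proof.
move=> hnd; suff [x hx] : exists x, forall w, h x w = phi w.
  exact: (@xgetI _ 0 [set y : g | forall w, h y w = phi w]%classic x hx).
set e := vbasis {:g}.
have ebasis : basis_of {:g} e := vbasisP _.
have decomp w : w = \sum_i coord e i w *: e`_i.
  by rewrite -(coord_basis ebasis) ?memvf.
pose F x := \sum_(i < \dim {:g}) h x e`_i *: e`_i.
have Flin : linear F.
  move=> a x y; rewrite /F scaler_sumr -big_split /=; apply: eq_bigr => i _.
  by rewrite linearPl /= scalerDl scalerA.
pose FL := GRing.isLinear.Build _ _ _ _ F Flin.
pose Fm : {linear g -> g} := HB.pack F FL.
have coordF x i : coord e i (F x) = h x e`_i.
  by rewrite (coord_sum_free _ _ (basis_free ebasis)).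
have Finj : lker (linfun Fm) == 0%VS.
  apply/lker0P => x y; rewrite !lfunE /= => eqF.
  apply/eqP; rewrite -subr_eq0; apply/eqP/(nondegenerateP hnd) => w.
  rewrite (decomp w) linear_sumr big1 //= => i _.
  by rewrite linearZr_LR /= linearBl /= -!coordF eqF subrr mulr0.
pose z := \sum_(i < \dim {:g}) phi e`_i *: e`_i.
have : z \in limg (linfun Fm) by rewrite lker0_limgf ?memvf.
case/memv_imgP => x _; rewrite lfunE /= => zF; exists x => w.
rewrite {1}(decomp w) [in RHS](decomp w) linear_sumr linear_sum.
apply: eq_bigr => i _; rewrite linearZr_LR linearZ /=; congr (_ * _).
by rewrite -coordF -zF (coord_sum_free _ _ (basis_free ebasis)).
Qed.

Lemma riesz_unique (h : {symmetric g}) (phi : g -> R) (x : g) :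
  nondegenerate h -> (forall w, h x w = phi w) -> riesz h phi = x.
Proof.
move=> hnd hx; apply: xget_unique => // y hy.
apply/eqP; rewrite -subr_eq0; apply/eqP/(nondegenerateP hnd) => w.
by rewrite linearBl /= hy hx subrr.
Qed.

Lemma nabla_koszul (br : {bilinear g -> g -> g}) (h : {symmetric g}) u v w :
  nondegenerate h ->
  2 * h (nabla br h u v) w = h (br u v) w + h (br w u) v + h (br w v) u.
Proof.
move=> hnd.
pose F w := 2^-1 * (h (br u v) w + h (br w u) v + h (br w v) u).
have Flin : scalar F.
  move=> a x y; rewrite /F !linearPr /= !(linearPl br) /= !linearPl /=.
  by ring.
pose Fm : {scalar g} := HB.pack F (GRing.isLinear.Build _ _ _ _ F Flin).
by rewrite (riesz_spec Fm hnd) /F mulrA divff ?mul1r // pnatr_eq0.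
Qed.

Lemma nabla_linearr (br : {bilinear g -> g -> g}) (h : {symmetric g}) u :
  nondegenerate h -> linear (nabla br h u).
Proof.
move=> hnd a x y; apply: riesz_unique => // w.
have two : (2 : R) != 0 by rewrite pnatr_eq0.
apply: (mulfI two); rewrite linearPl /= mulrDr mulrCA !nabla_koszul //.
rewrite mulrA divff // mul1r !linearPr /= linearPl /= !linearPl /=; ring.
Qed.

Lemma Ric_spec (br : {bilinear g -> g -> g}) (h : {symmetric g}) u v :
  nondegenerate h -> h (Ric br h u) v = ric br h u v.
Proof.
move=> hnd; have Flin : scalar (ric br h u).
  move=> a x y; rewrite /ric /lintrace /mxtrace mulr_sumr -big_split /=.
  apply: eq_bigr => i _; rewrite !mxE -linearP /=; congr (coord _ _ _).
  have subACA (A B C A' B' C' : g) : (a *: A + A') - (a *: B + B' - (a *: C + C'))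
      = a *: (A - (B - C)) + (A' - (B' - C')).
    rewrite !scalerBr (opprD (a *: C)) (addrACA (a *: B)).
    by rewrite (opprD (a *: B - a *: C)) addrACA.
  by rewrite /curv !nabla_linearr // subACA.
pose Fm : {scalar g} :=
  HB.pack (ric br h u) (GRing.isLinear.Build _ _ _ _ _ Flin).
exact: (riesz_spec Fm hnd).
Qed.

Lemma lintrace_basis n (b : n.-tuple g) (f : {linear g -> g}) :
  basis_of {:g} b -> lintrace f = \tr (mx_in b f).
Proof.
move=> bb; rewrite /lintrace; set e := vbasis {:g}.
have eb : basis_of {:g} e := vbasisP _.
pose P : 'M[R]_(\dim {:g}, n) := \matrix_(i, j) coord e i b`_j.
pose Q : 'M[R]_(n, \dim {:g}) := \matrix_(i, j) coord b i e`_j.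
have PM : mx_in e f *m P = P *m mx_in b f.
  apply/matrixP => i j; rewrite !mxE.
  transitivity (coord e i (f b`_j)).
    rewrite [in RHS](coord_basis eb (memvf b`_j)) !linear_sum /=.
    by apply: eq_bigr => k _; rewrite !mxE !linearZ /= mulrC.
  rewrite [in LHS](coord_basis bb (memvf (f b`_j))) !linear_sum /=.
  by apply: eq_bigr => k _; rewrite !mxE !linearZ /= mulrC.
have PQ : P *m Q = 1%:M.
  apply/matrixP => i j; rewrite !mxE.
  transitivity (coord e i e`_j); last first.
    by rewrite (coord_free _ _ (basis_free eb)) eq_sym.
  rewrite [in RHS](coord_basis bb (memvf e`_j)) linear_sum /=.
  by apply: eq_bigr => k _; rewrite !mxE linearZ /= mulrC.
have QP : Q *m P = 1%:M.
  apply/matrixP => i j; rewrite !mxE.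
  transitivity (coord b i b`_j); last first.
    by rewrite (coord_free _ _ (basis_free bb)) eq_sym.
  rewrite [in RHS](coord_basis eb (memvf b`_j)) linear_sum /=.
  by apply: eq_bigr => k _; rewrite !mxE linearZ /= mulrC.
by rewrite -[mx_in e f]mulmx1 -PQ mulmxA PM -mulmxA mxtrace_mulC -mulmxA QP mulmx1.
Qed.

Lemma lcross_basis (y1 y2 y3 : g) :
  basis_of {:g} [:: y1; y2; y3] ->
  [/\ lcross y1 y2 y3 y1 y2 = - y3, lcross y1 y2 y3 y2 y3 = y1
    & lcross y1 y2 y3 y3 y1 = y2].
Proof.
move=> yb; have fr : free [tuple y1; y2; y3] := basis_free yb.
have cE (i j : 'I_3) : coord [tuple y1; y2; y3] i [tuple y1; y2; y3]`_j
    = (j == i)%:R by rewrite (coord_free _ _ fr) eq_sym.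
have c1 i := cE i 0; have c2 i := cE i 1; have c3 i := cE i 2%:R.
rewrite /= in c1 c2 c3.
split; rewrite /lcross ?c1 ?c2 ?c3 /=.
- by rewrite !(mul0r, mul1r, mulr0, subr0, sub0r, subrr, oppr0, scale0r, scale1r, add0r, addr0).
- by rewrite !(mul0r, mul1r, mulr0, subr0, sub0r, subrr, oppr0, scale0r, scale1r, add0r, addr0).
- by rewrite !(mul0r, mul1r, mulr0, subr0, sub0r, subrr, oppr0, scale0r, scale1r, add0r, addr0).
Qed.

End LorentzianLieAlgebra.

(* Main.v *)
Require Import Defs.
From HB Require Import structures.
From mathcomp Require Import all_boot all_order all_algebra.
From mathcomp Require Import boolp classical_sets reals.
From mathcomp Require Import ring.

Set Implicit Arguments.
Unset Strict Implicit.
Unset Printing Implicit Defensive.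
Import Order.TTheory GRing.Theory Num.Theory.
Local Open Scope ring_scope.

(* The metric connection makes h (R_uv w, z) alternating in (u, v) and in
   (w, z). In dimension three an alternating form is determined by its values
   on (y2, y3), (y3, y1), (y1, y2), with as coefficients the coordinates of the
   cross product. Hence h (R_uv u, v) and ric (u x v, u x v) are quadratic forms
   in the same three coordinates, and their coefficients can be compared;
   pair symmetry of R is not required, as a quadratic form only sees the
   symmetrized coefficients. *)

(** * Coordinates in a Lorentzian orthonormal frame *)

Section OrthonormalCoordinates.
Variables (R : realType) (g : vectType R) (h : {symmetric g}) (y1 y2 y3 : g).
Hypothesis oy : is_orthonormal_basis h y1 y2 y3.
Let c := coord [tuple y1; y2; y3].

Lemma symmetric_formC (u v : g) : h u v = h v u.
Proof. by rewrite hermC expr0 mul1r. Qed.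

Lemma orthonormal_decomp w : w = c 0 w *: y1 + c 1 w *: y2 + c 2%:R w *: y3.
Proof.
case: oy => yb _ _.
rewrite {1}(coord_basis (X := [tuple y1; y2; y3]) yb (memvf w)).
rewrite !big_ord_recl big_ord0 /= addr0 addrA.
by congr (_ *: _ + _ *: _ + _ *: _); congr (coord _ _ _); apply: val_inj.
Qed.

Lemma orthonormal_comb a1 a2 a3 (x := a1 *: y1 + a2 *: y2 + a3 *: y3) :
  [/\ h x y1 = a1, h x y2 = a2 & h x y3 = - a3].
Proof.
case: oy => _ [h11 h22 h33] [h12 h13 h23].
rewrite /x !(linearDl, linearZl_LR) /= h11 h22 h33 h12 h13 h23.
rewrite (symmetric_formC y2) (symmetric_formC y3 y1) (symmetric_formC y3 y2).
by rewrite h12 h13 h23; split; ring.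
Qed.

(** The timelike [y3], with [h y3 y3 = -1], is the source of the sign on the third coordinate, and
    hence of every minus sign in the frame formulas below. *)
Lemma coord_orthonormal w :
  [/\ c 0 w = h w y1, c 1 w = h w y2 & c 2%:R w = - h w y3].
Proof.
have := orthonormal_comb (c 0 w) (c 1 w) (c 2%:R w).
by rewrite -orthonormal_decomp => -[-> -> ->]; rewrite opprK.
Qed.

Lemma scalar_orthonormal (F : g -> R) w :
  scalar F -> F w = h w y1 * F y1 + h w y2 * F y2 - h w y3 * F y3.
Proof.
move=> Flin; have F0 : F 0 = 0.
  by have := Flin 1 0 0; rewrite scale1r addr0 mul1r -{1}[F 0]addr0 => /addrI.
have [<- <- /(congr1 -%R)] := coord_orthonormal w; rewrite opprK => <-.
(* The trailing [+ 0] gives the last summand the shape [a *: x + y] that [Flin] matches. *)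
rewrite [in LHS](orthonormal_decomp w) -addrA -[_ *: y3]addr0 !Flin F0.
by rewrite addr0 mulNr opprK addrA.
Qed.

Lemma lintrace_orthonormal (f : {linear g -> g}) :
  lintrace f = h (f y1) y1 + h (f y2) y2 - h (f y3) y3.
Proof.
case: (oy) => yb _ _.
rewrite (lintrace_basis (b := [tuple y1; y2; y3]) f yb) /mxtrace.
rewrite !big_ord_recl big_ord0 /= addr0 !mxE /= addrA.
have [<- _ _] := coord_orthonormal (f y1).
have [_ <- _] := coord_orthonormal (f y2).
have [_ _ <-] := coord_orthonormal (f y3).
by congr (_ + _ + _); congr (coord _ _ _); apply: val_inj.
Qed.

(** Expanding both arguments leaves the three 2 by 2 minors of the coordinates. The minus in
    [y1 x y2 = - y3] cancels against [h y3 y3 = -1], so all three enter with the same sign. *)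
Lemma alternating_lcross (B : g -> g -> R) (u v : g)
    (n := lcross y1 y2 y3 u v) :
  (forall v, scalar (B^~ v)) -> (forall u v, B u v = - B v u) ->
  B u v = h n y1 * B y2 y3 + h n y2 * B y3 y1 + h n y3 * B y1 y2.
Proof.
move=> Blin Bskew.
have Bl x z : B x z = c 0 x * B y1 z + c 1 x * B y2 z + c 2%:R x * B y3 z.
  rewrite (scalar_orthonormal x (Blin z)) -mulNr.
  by have [-> -> ->] := coord_orthonormal x.
have B0 x : B x x = 0.
  by apply/eqP; rewrite -[_ == 0](mulrn_eq0 _ 2) mulr2n {1}Bskew addNr.
rewrite /n /lcross -scaleNr -/c.
have [-> -> ->] := orthonormal_comb (c 1 u * c 2%:R v - c 2%:R u * c 1 v)
  (c 2%:R u * c 0 v - c 0 u * c 2%:R v) (- (c 0 u * c 1 v - c 1 u * c 0 v)).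
(* Linearity is given in the first slot only, so skewness moves [v] there before it is expanded. *)
rewrite (Bl u) !(Bskew _ v) !(Bl v) !B0 (Bskew y2 y1) (Bskew y1 y3) (Bskew y3 y2).
ring.
Qed.

End OrthonormalCoordinates.

(** * Symmetries of the connection and of the curvature *)

Section Curvature.
Variables (R : realType) (g : vectType R) (br : {bilinear g -> g -> g}).
Variable h : {symmetric g}.
Hypotheses (lie_br : is_lie_bracket br) (h_nd : nondegenerate h).

Lemma lie_skew u v : br u v = - br v u.
Proof.
apply/eqP; rewrite -addr_eq0; apply/eqP.
have := lie_alternating lie_br (u + v).
by rewrite linearDl !linearDr /= !(lie_alternating lie_br) add0r addr0.
Qed.

Lemma nabla_linearl v : linear (nabla br h ^~ v).
Proof.
move=> a x y; apply: riesz_unique => // w.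
have two : (2 : R) != 0 by rewrite pnatr_eq0.
apply: (mulfI two); rewrite linearPl /= mulrDr mulrCA !nabla_koszul //.
rewrite mulrA divff // mul1r !linearPl /= !linearPr /= !linearPl /=; ring.
Qed.

(** By skewness of the bracket, exchanging [v] and [w] reverses the sign of the right-hand side of
    the Koszul formula. *)
Lemma nabla_metric u v w : h (nabla br h u v) w = - h (nabla br h u w) v.
Proof.
have two : (2 : R) != 0 by rewrite pnatr_eq0.
apply: (mulfI two); rewrite mulrN !nabla_koszul //.
rewrite (lie_skew u v) (lie_skew u w) (lie_skew w v) !linearNl /=; ring.
Qed.

Lemma curv_linearl v w : linear (fun u => curv br h u v w).
Proof.
move=> a x y; rewrite /curv linearPl /= !nabla_linearl nabla_linearr //.
rewrite !scalerBr (opprD (a *: nabla _ _ v _)) (addrACA (a *: nabla _ _ x _)).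
by rewrite (opprD (a *: _ - a *: _)) addrACA.
Qed.

Lemma curv_linearr u v : linear (curv br h u v).
Proof.
move=> a x y; rewrite /curv !nabla_linearr //.
rewrite !scalerBr (opprD (a *: nabla _ _ v _)) (addrACA (a *: nabla _ _ u _)).
by rewrite (opprD (a *: _ - a *: _)) addrACA.
Qed.

Lemma curv_skewl u v w : curv br h u v w = - curv br h v u w.
Proof.
have nablaN x : nabla br h (- x) w = - nabla br h x w.
  pose F := GRing.isLinear.Build _ _ _ _ _ (nabla_linearl w).
  exact: (linearN (HB.pack (nabla br h ^~ w) F : {linear g -> g})).
by rewrite /curv lie_skew nablaN [RHS]opprB opprB addrC.
Qed.

(** Each [nabla br h u] is skew-adjoint for [h] by [nabla_metric], and commutators of skew-adjoint
    maps are again skew-adjoint. *)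
Lemma curv_skewr u v w z : h (curv br h u v w) z = - h (curv br h u v z) w.
Proof.
rewrite /curv !linearBl /= (nabla_metric _ w) (nabla_metric _ (nabla _ _ v w)).
rewrite (nabla_metric _ (nabla _ _ u w)) (nabla_metric u (nabla _ _ v z)).
rewrite (nabla_metric v (nabla _ _ u z)) (symmetric_formC _ (nabla br h u w)).
rewrite (symmetric_formC _ (nabla br h u z)); ring.
Qed.

Lemma ric_linearl v : scalar (ric br h ^~ v).
Proof.
move=> a x y; rewrite /ric /lintrace /mxtrace mulr_sumr -big_split /=.
by apply: eq_bigr => i _; rewrite !mxE curv_linearl linearP.
Qed.

Lemma Ric_linear : linear (Ric br h).
Proof.
move=> a x y; apply: riesz_unique => // w.
by rewrite linearPl /= !Ric_spec // ric_linearl.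
Qed.

(** * Ricci and scalar curvature in an orthonormal basis *)

Section OrthonormalBasis.
Variables y1 y2 y3 : g.
Hypothesis oy : is_orthonormal_basis h y1 y2 y3.

Lemma ric_orthonormal u v :
  ric br h u v = h (curv br h u y1 v) y1 + h (curv br h u y2 v) y2
                 - h (curv br h u y3 v) y3.
Proof.
have Flin : linear (fun w => curv br h u w v).
  by move=> a x y; rewrite !(curv_skewl u) curv_linearl scalerN opprD.
pose F := GRing.isLinear.Build _ _ _ _ _ Flin.
exact: (lintrace_orthonormal oy (HB.pack (fun w => curv br h u w v) F)).
Qed.

Lemma scal_orthonormal :
  scal br h = ric br h y1 y1 + ric br h y2 y2 - ric br h y3 y3.
Proof.
pose F := GRing.isLinear.Build _ _ _ _ _ Ric_linear.
by rewrite /scal (lintrace_orthonormal oy (HB.pack (Ric br h) F)) /= !Ric_spec.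
Qed.

(** The division-free form of the main identity: the left side is the numerator of [sec], and
    orthogonality of [u] and [v] only serves later to simplify the denominator. *)
Lemma curv_lcross u v (n := lcross y1 y2 y3 u v) :
  h (curv br h u v u) v = - (h n n * (scal br h / 2) - ric br h n n).
Proof.
pose K x y w z := h (curv br h x y w) z.
have Klinl y w z : scalar (fun x => K x y w z).
  by move=> a x x'; rewrite /K curv_linearl linearPl.
have Klinr x y z : scalar (fun w => K x y w z).
  by move=> a w w'; rewrite /K curv_linearr linearPl.
have Kskewl x y w z : K x y w z = - K y x w z.
  by rewrite /K curv_skewl linearNl.
have Kskewr x y w z : K x y w z = - K x y z w by exact: curv_skewr.
have ricE x y : ric br h x y = K x y1 y y1 + K x y2 y y2 - K x y3 y y3.
  exact: ric_orthonormal.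
have ric_comb x : ric br h x n
    = h n y1 * ric br h x y1 + h n y2 * ric br h x y2 - h n y3 * ric br h x y3.
  apply: (scalar_orthonormal oy) => a y y'.
  (* Linearity of [ric] in its second argument is inherited from [h] through the Ricci operator. *)
  by rewrite -!Ric_spec // linearPr.
have nn : h n n = h n y1 * h n y1 + h n y2 * h n y2 - h n y3 * h n y3.
  by apply: (scalar_orthonormal oy) => a y y'; rewrite linearPr.
rewrite -/(K u v u v) scal_orthonormal nn.
rewrite (scalar_orthonormal oy n (ric_linearl n)) !ric_comb !ricE.
(* From here [K] is an abstract array, known only through linearity in its first and third slots and
   its two skew symmetries. *)
clearbody K.
have Kl w z : K u v w z
    = h n y1 * K y2 y3 w z + h n y2 * K y3 y1 w z + h n y3 * K y1 y2 w z.
  by apply: (alternating_lcross oy (B := fun x y => K x y w z)).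
have Kr x y : K x y u v
    = h n y1 * K x y y2 y3 + h n y2 * K x y y3 y1 + h n y3 * K x y y1 y2.
  by apply: (alternating_lcross oy (B := K x y)).
have Kll x w z : K x x w z = 0.
  by apply/eqP; rewrite -[_ == 0](mulrn_eq0 _ 2) mulr2n {1}Kskewl addNr.
have Krr x y w : K x y w w = 0.
  by apply/eqP; rewrite -[_ == 0](mulrn_eq0 _ 2) mulr2n {1}Kskewr addNr.
(* Ordering each index pair as (2,3), (3,1) or (1,2) leaves nine entries of [K], and the claim
   becomes a polynomial identity in them and the products of [h n] with the frame. *)
rewrite Kl !Kr !Kll !Krr !(Kskewl y2 y1) !(Kskewl y1 y3) !(Kskewl y3 y2).
rewrite !(Kskewr _ _ y2 y1) !(Kskewr _ _ y1 y3) !(Kskewr _ _ y3 y2).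
by field.
Qed.

End OrthonormalBasis.
End Curvature.

Theorem lemma3p7 (R : realType) (g : vectType R)
    (br : {bilinear g -> g -> g}) (h : {symmetric g}) (y1 y2 y3 : g)
    (dim_g : \dim {:g} = 3%N)
    (lie_br : is_lie_bracket br)
    (lor_h : is_lorentzian h)
    (ortho_y : is_orthonormal_basis h y1 y2 y3) :
  let kappa := sec br h in
  let ric := ric br h in
  let rho := scal br h in
  let cross := lcross y1 y2 y3 in
  let Rm := Ric_mx br h y1 y2 y3 in
  let R11 := Rm 0 0 in
  let R22 := Rm 1 1 in
  let R33 := Rm 2%:R 2%:R in
  (forall u v : g, h u v = 0 -> h u u * h v v != 0 ->
     h u u * h v v * kappa u v =
       - (h (cross u v) (cross u v) * (rho / 2)
          - ric (cross u v) (cross u v)))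
  /\ (kappa y1 y2 = rho / 2 + ric y3 y3
      /\ kappa y1 y2 = 2^-1 * (R11 + R22 - R33))
  /\ (kappa y2 y3 = rho / 2 - ric y1 y1
      /\ kappa y2 y3 = 2^-1 * (- R11 + R22 + R33))
  /\ (kappa y3 y1 = rho / 2 - ric y2 y2
      /\ kappa y3 y1 = 2^-1 * (R11 - R22 + R33)).
Proof.
case: lor_h => h_nd _ kappa ricc rho cross Rm R11 R22 R33.
case: (ortho_y) => yb [h11 h22 h33] [h12 h13 h23].
have kappaE u v : h u v = 0 -> h u u * h v v != 0 ->
    h u u * h v v * kappa u v
      = - (h (cross u v) (cross u v) * (rho / 2) - ricc (cross u v) (cross u v)).
  move=> uv0 uv_neq0; rewrite -(curv_lcross lie_br h_nd ortho_y).
  by rewrite /kappa /sec uv0 expr0n subr0 mulrC divfK.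
have [c12 c23 c31] := lcross_basis yb.
(* Absorbs the sign in [y1 x y2 = - y3]. *)
have ricNN x : ricc (- x) (- x) = ricc x x.
  pose F := GRing.isLinear.Build _ _ _ _ _ (Ric_linear br h_nd).
  have RicN : Ric br h (- x) = - Ric br h x.
    exact: (linearN (HB.pack (Ric br h) F : {linear g -> g})).
  rewrite /ricc -Ric_spec // RicN linearNl linearNr /= opprK.
  by rewrite Ric_spec.
(* The sign of [R33] reconciles [+ ric y3 y3] with [- R33] in the formula for the plane of [y1] and
   [y2]. *)
have RmE : [/\ R11 = ricc y1 y1, R22 = ricc y2 y2 & R33 = - ricc y3 y3].
  rewrite /R11 /R22 /R33 /Rm /Ric_mx !mxE /= /ricc -!Ric_spec //.
  have [<- _ _] := coord_orthonormal ortho_y (Ric br h y1).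
  have [_ <- _] := coord_orthonormal ortho_y (Ric br h y2).
  by have [_ _ <-] := coord_orthonormal ortho_y (Ric br h y3).
have rhoE : rho = R11 + R22 + R33.
  by have [-> -> ->] := RmE; exact: scal_orthonormal.
have k12 : kappa y1 y2 = rho / 2 + ricc y3 y3.
  have := kappaE y1 y2 h12; rewrite /cross c12 ricNN linearNl linearNr /=.
  rewrite h11 h22 h33 mulr1 oner_eq0 mul1r => -> //; ring.
(* Here [h y2 y2 * h y3 y3 = -1] cancels the overall minus of [kappaE], while the normal [y1] has
   norm 1; the next plane behaves alike. *)
have k23 : kappa y2 y3 = rho / 2 - ricc y1 y1.
  have := kappaE y2 y3 h23; rewrite /cross c23 h11 h22 h33 mul1r.
  by rewrite oppr_eq0 oner_eq0 mulN1r mul1r => /(_ isT) /oppr_inj.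
have k31 : kappa y3 y1 = rho / 2 - ricc y2 y2.
  have := kappaE y3 y1; rewrite symmetric_formC h13 /cross c31 h11 h22 h33 mulr1.
  by rewrite oppr_eq0 oner_eq0 mulN1r mul1r => /(_ erefl isT) /oppr_inj.
split; first exact: kappaE.
have [r1 r2 r3] := RmE; rewrite k12 k23 k31 rhoE r1 r2 r3.
by do ![split] => //; field.
Qed.
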